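(* The generating function of the total sizes $h(s)$ of all $(s,s+1,s+2)$-core partitions is $$H(x)=\sum_{s\ge 0}h(s)x^s=\frac{x^2}{(1-2x-3x^2)^{5/2}}.$$
   Context: A partition is an $(s,s+1,s+2)$-core if no hook length of a box of its Young diagram is divisible by $s$, $s+1$ or $s+2$. $h(s)$ is the sum of the sizes of all $(s,s+1,s+2)$-core partitions (with $h(0)=h(1)=0$, the only such partition for $s\le 1$ being the empty one). *)

(* Defs.v *)
From HB Require Import structures.
From mathcomp Require Import all_boot all_order all_algebra.
Set Implicit Arguments. Unset Strict Implicit. Unset Printing Implicit Defensive.
Import Order.TTheory GRing.Theory Num.Theory.

Definition is_partition (la : seq nat) : bool :=
  sorted geq la && all (fun x => 0 < x) la.

Definition psize (la : seq nat) : nat := sumn la.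

(* length of column j (0-indexed) of the Young diagram = conjugate part *)
Definition conj_part (la : seq nat) (j : nat) : nat := count (fun x => j < x) la.

Definition in_diagram (la : seq nat) (i j : nat) : bool := j < nth 0 la i.

Definition hook (la : seq nat) (i j : nat) : nat :=
  (nth 0 la i - j.+1) + (conj_part la j - i.+1) + 1.

Definition is_core3 (s : nat) (la : seq nat) : Prop :=
  forall i j, in_diagram la i j ->
    ~~ (s %| hook la i j) /\ ~~ (s.+1 %| hook la i j) /\ ~~ (s.+2 %| hook la i j).

Definition Pbase : {poly rat} := (1 - 2%:R *: 'X - 3%:R *: 'X^2)%R.

(* F is the coefficient sequence of the formal power series
   (1 - 2x - 3x^2)^(-5/2): the unique series F with F_0 = 1 and
   F^2 * (1 - 2x - 3x^2)^5 = 1. *)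
Definition is_pow_m5half (F : nat -> rat) : Prop :=
  F 0%N = 1%R /\
  forall n : nat,
    (\sum_(i < n.+1) \sum_(j < (n - i).+1) F i * F j * (Pbase ^+ 5)`_(n - i - j))%R
    = ((n == 0%N)%:R)%R.

(* Main.v *)
Require Import Defs.
From HB Require Import structures.
From mathcomp Require Import all_boot all_order all_algebra.
From mathcomp Require Import boolp ring lra zify.
Import Order.TTheory GRing.Theory Num.Theory.
Set Implicit Arguments. Unset Strict Implicit. Unset Printing Implicit Defensive.

(** The first-column hook lengths of a partition form a set X of positive
    integers, and the partition is a t-core iff X is stable under subtracting t.
    Placing X on an abacus with s+1 runners, stability under s+1 means that runner
    i carries beads exactly in its first m_i rows, while stability under s and s+2
    together with 0 not in X means m_0 = m_s = 0 and |m_i - m_(i+1)| <= 1.  So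
    (s,s+1,s+2)-cores correspond to Motzkin paths of length s, and twice the size
    of the core is a polynomial in the number of points, the area, the sum of
    squares and the first moment of the heights.

    To sum this over all paths, let the paths start at any height k.  Adding a first
    step turns the generating functions of the statistics into linear systems
    Y_k = g_k + x (Y_(k-1) + Y_k + Y_(k+1)), each with a unique solution.  With
    r = x (1 + r + r^2) the solutions are p(k) r^k for explicit polynomials p whose
    coefficients are rational in r; finally
    1 - 2x - 3x^2 = ((1 - r^2) / (1 + r + r^2))^2. *)

(** * Formal power series *)

Definition fps (R : Type) : Type := nat -> R.

Section PowerSeries.
Local Open Scope ring_scope.
Variable R : comNzRingType.
Implicit Types (f g h : fps R) (p : {poly R}) (n : nat).

HB.instance Definition _ := gen_eqMixin (fps R).
HB.instance Definition _ := gen_choiceMixin (fps R).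

Definition fps_add f g : fps R := fun n => f n + g n.
Definition fps_opp f : fps R := fun n => - f n.
Definition fps_of_poly p : fps R := fun n => p`_n.
Definition fps_mul f g : fps R := fun n => \sum_(i < n.+1) f i * g (n - i)%N.

Fact fps_addA : associative fps_add.
Proof. by move=> f g h; apply/funext => n; apply: addrA. Qed.
Fact fps_addC : commutative fps_add.
Proof. by move=> f g; apply/funext => n; apply: addrC. Qed.
Fact fps_add0 : left_id (fps_of_poly 0) fps_add.
Proof. by move=> f; apply/funext => n; rewrite /fps_add /fps_of_poly coef0 add0r. Qed.
Fact fps_addN : left_inverse (fps_of_poly 0) fps_opp fps_add.
Proof.
by move=> f; apply/funext => n; rewrite /fps_add /fps_of_poly coef0; apply: addNr.
Qed.

HB.instance Definition _ :=
  GRing.isZmodule.Build (fps R) fps_addA fps_addC fps_add0 fps_addN.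

Definition truncate n f : {poly R} := \poly_(i < n) f i.

Lemma coef_truncate n f i : (i < n)%N -> (truncate n f)`_i = f i.
Proof. by move=> lt_in; rewrite coef_poly lt_in. Qed.

(** Coefficient n involves only terms of degree at most n, so associativity and commutativity are
    inherited from polynomials. *)
Lemma fps_mul_truncate N n f g : (n < N)%N ->
  fps_mul f g n = (truncate N f * truncate N g)`_n.
Proof.
move=> ltnN; rewrite coefM; apply: eq_bigr => i _.
have lt_i := ltn_ord i; by rewrite !coef_truncate //; lia.
Qed.

Fact fps_mulA : associative fps_mul.
Proof.
move=> f g h; apply/funext => n.
transitivity (truncate n.+1 f * (truncate n.+1 g * truncate n.+1 h))`_n.
  rewrite coefM; apply: eq_bigr => i _.
  have lt_i := ltn_ord i; by rewrite coef_truncate // (@fps_mul_truncate n.+1) //; lia.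
rewrite mulrA coefM; apply: eq_bigr => i _.
have lt_i := ltn_ord i; rewrite -(@fps_mul_truncate n.+1) // coef_truncate //; lia.
Qed.

Fact fps_mulC : commutative fps_mul.
Proof. by move=> f g; apply/funext => n; rewrite !(@fps_mul_truncate n.+1) // mulrC. Qed.

Fact fps_mul1 : left_id (fps_of_poly 1) fps_mul.
Proof.
move=> f; apply/funext => n; rewrite /fps_mul big_ord_recl /fps_of_poly coef1 mul1r.
by rewrite big1 ?addr0 ?subn0 // => i _; rewrite coef1 mul0r.
Qed.

Fact fps_mulDl : left_distributive fps_mul +%R.
Proof.
move=> f g h; apply/funext => n; rewrite [RHS]/GRing.add /= /fps_add -big_split.
by apply: eq_bigr => i _; apply: mulrDl.
Qed.

Fact fps_one_neq0 : fps_of_poly 1 != 0 :> fps R.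
Proof.
apply/eqP => /(congr1 (fun f : fps R => f 0)) /eqP.
by rewrite /fps_of_poly coef1 [0 in X in _ == X]/GRing.zero /= /fps_of_poly coef0 oner_eq0.
Qed.

HB.instance Definition _ :=
  GRing.Zmodule_isComNzRing.Build (fps R) fps_mulA fps_mulC fps_mul1 fps_mulDl
    fps_one_neq0.

Lemma fpsD f g n : (f + g) n = f n + g n. Proof. by []. Qed.
Lemma fpsN f n : (- f) n = - f n. Proof. by []. Qed.
Lemma fpsM f g n : (f * g) n = \sum_(i < n.+1) f i * g (n - i)%N. Proof. by []. Qed.
Lemma fps0 n : (0 : fps R) n = 0. Proof. exact: coef0. Qed.
Lemma fps1 n : (1 : fps R) n = (n == 0)%:R. Proof. exact: coef1. Qed.

Lemma fpsM0 f g : (f * g) 0 = f 0 * g 0.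
Proof. by rewrite fpsM big_ord1. Qed.

Lemma fpsX0 f n : (f ^+ n) 0 = f 0 ^+ n.
Proof. by elim: n => [|n IH]; [rewrite !expr0 fps1 | rewrite !exprS fpsM0 IH]. Qed.

Lemma fps_natl (k : nat) f n : (k%:R * f) n = k%:R * f n.
Proof. by elim: k => [|k IH]; rewrite ?mul0r ?fps0 // -!natr1 !mulrDl !mul1r fpsD IH. Qed.

Fact fps_of_poly_zmod : zmod_morphism fps_of_poly.
Proof. by move=> p q; apply/funext => n; apply: coefB. Qed.
Fact fps_of_poly_monoid : monoid_morphism fps_of_poly.
Proof. by split=> // p q; apply/funext => n; apply: coefM. Qed.
HB.instance Definition _ :=
  GRing.isZmodMorphism.Build {poly R} (fps R) fps_of_poly fps_of_poly_zmod.
HB.instance Definition _ :=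
  GRing.isMonoidMorphism.Build {poly R} (fps R) fps_of_poly fps_of_poly_monoid.

Definition fpsX : fps R := fps_of_poly 'X.

Lemma fps_mulX0 f : (fpsX * f) 0 = 0.
Proof. by rewrite fpsM0 /fpsX /fps_of_poly coefX mul0r. Qed.

Lemma fps_mulXS f n : (fpsX * f) n.+1 = f n.
Proof.
rewrite fpsM 2!big_ord_recl /= /fpsX /fps_of_poly !coefX mul0r mul1r add0r /bump /=.
by rewrite subSS subn0 big1 ?addr0 // => i _; rewrite coefX mul0r.
Qed.

(** When coefficient n of [T f] depends only on the coefficients of [f] below n, the iterates of [T]
    from 0 stabilize coefficient by coefficient. *)
Lemma fps_contraction (T : fps R -> fps R) :
  (forall n f g, (forall i, (i < n)%N -> f i = g i) ->
     forall i, (i <= n)%N -> T f i = T g i) ->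
  exists f, f = T f.
Proof.
move=> Tcontr; pose u n := iter n T 0.
have uS m n i : (i < n)%N -> u n i = u (n + m)%N i.
  elim: n i => // n IH i lt_in; rewrite addSn /=; exact: (Tcontr n).
(* Coefficient n is final from iterate n + 1 on, so the limit is this diagonal. *)
exists (fun n => u n.+1 n); apply/funext => n /=.
apply: (Tcontr n) => // i lt_in.
by rewrite -(subnKC lt_in) -uS.
Qed.

Lemma fps_mulX_ext n f g : (forall i, (i < n)%N -> f i = g i) ->
  forall i, (i <= n)%N -> (fpsX * f) i = (fpsX * g) i.
Proof. by move=> fg [|i] lt_in; rewrite ?fps_mulX0 // !fps_mulXS fg. Qed.

Lemma fps_mul_ext n f f' g g' : (forall i, (i < n)%N -> f i = f' i) ->
    (forall i, (i < n)%N -> g i = g' i) ->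
  forall i, (i < n)%N -> (f * g) i = (f' * g') i.
Proof.
move=> ff gg i lt_in; rewrite !fpsM; apply: eq_bigr => j _.
by rewrite ff ?gg //; have := ltn_ord j; lia.
Qed.

(** The inverse is the fixed point of g = 1 + X f g, contractive because of the factor X. *)
Lemma fps_inv1X f : exists g, g * (1 - fpsX * f) = 1.
Proof.
have [n g g' gg' i le_in|g gE] := @fps_contraction (fun g => 1 + fpsX * (f * g)).
  rewrite !fpsD; congr (_ + _); apply: fps_mulX_ext le_in => j lt_jn.
  exact: (fps_mul_ext (n := n)).
by exists g; rewrite mulrBr mulr1 [g in g - _]gE; ring.
Qed.

End PowerSeries.

Lemma motzkin_series : exists r : fps rat, (r = fpsX rat * (1 + r + r ^+ 2))%R.
Proof.
apply: fps_contraction => n f g fg; apply: fps_mulX_ext => i lt_in.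
rewrite !fpsD fg //; congr (_ + _)%R; rewrite !expr2.
exact: (fps_mul_ext (n := n)).
Qed.

(** * Statistics of Motzkin paths *)

(* The height sequences (n.+1 points) of the paths from height k to height 0. *)
Fixpoint motzkin (n k : nat) : seq (seq nat) :=
  if n is n'.+1 then
    [seq k :: l | l <- (if k is k'.+1 then motzkin n' k' else [::])
                         ++ motzkin n' k ++ motzkin n' k.+1]
  else if k is 0 then [:: [:: 0]] else [::].

Definition sumsq (l : seq nat) : nat := \sum_(i < size l) nth 0 l i ^ 2.
Definition moment (l : seq nat) : nat := \sum_(i < size l) i * nth 0 l i.

Lemma sumsq_cons k l : sumsq (k :: l) = k ^ 2 + sumsq l.
Proof. by rewrite /sumsq big_ord_recl. Qed.

Lemma sumn_nth l : sumn l = \sum_(i < size l) nth 0 l i.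
Proof. by elim: l => [|k l IH]; rewrite ?big_ord0 // big_ord_recl /= IH. Qed.

Lemma moment_cons k l : moment (k :: l) = sumn l + moment l.
Proof.
rewrite /moment big_ord_recl mul0n add0n sumn_nth -big_split.
by apply: eq_bigr => i _; rewrite /= /bump /= add1n mulSn.
Qed.

(** * Linear systems for the statistics, indexed by the starting height *)

Section GeneratingFunctions.
Local Open Scope ring_scope.
Local Notation "'x" := (fpsX rat).
Implicit Types (w : seq nat -> rat) (Y : nat -> fps rat) (k n : nat).

(** The value 0 below height 0 keeps paths from crossing the axis. *)
Definition neighbours Y k : fps rat :=
  (if k is k'.+1 then Y k' else 0) + Y k + Y k.+1.

Definition path_gf w k : fps rat := fun n => \sum_(l <- motzkin n k) w l.

Lemma path_gf_rec w k :
  path_gf w k = fps_of_poly (if k == 0 then (w [:: 0%N])%:P else 0)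
                + 'x * neighbours (path_gf (w \o cons k)) k.
Proof.
apply/funext => -[|n].
  rewrite fpsD fps_mulX0 addr0 /path_gf /fps_of_poly.
  by case: k => [|k] /=; rewrite ?big_nil ?coef0 // big_seq1 coefC.
rewrite fpsD fps_mulXS /fps_of_poly.
rewrite (_ : _`_n.+1 = 0) ?add0r; last by case: ifP; rewrite ?coef0 ?coefC.
rewrite /path_gf /= big_map !big_cat /= addrA /neighbours !fpsD.
by case: k => [|k]; rewrite ?fps0 ?big_nil.
Qed.

Lemma path_gf_ext w w' k : w =1 w' -> path_gf w k = path_gf w' k.
Proof. by move=> ww; apply/funext => n; apply: eq_bigr. Qed.

Lemma path_gf_rec0 w k : w [:: 0%N] = 0 ->
  path_gf w k = 'x * neighbours (path_gf (w \o cons k)) k.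
Proof. by move=> w0; rewrite path_gf_rec w0 polyC0 if_same raddf0 add0r. Qed.

Lemma path_gfD w w' k :
  path_gf (fun l => w l + w' l) k = path_gf w k + path_gf w' k.
Proof. by apply/funext => n; rewrite fpsD -big_split. Qed.

Lemma path_gfN w k : path_gf (fun l => - w l) k = - path_gf w k.
Proof. by apply/funext => n; rewrite fpsN /path_gf sumrN. Qed.

Lemma path_gfM (c : nat) w k : path_gf (fun l => c%:R * w l) k = c%:R * path_gf w k.
Proof. by apply/funext => n; rewrite fps_natl /path_gf mulr_sumr. Qed.

Lemma neighboursD Y Y' k :
  neighbours (fun j => Y j + Y' j) k = neighbours Y k + neighbours Y' k.
Proof. by rewrite /neighbours; case: k => [|k]; ring. Qed.

Lemma neighboursN Y k : neighbours (fun j => - Y j) k = - neighbours Y k.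
Proof. by rewrite /neighbours; case: k => [|k]; ring. Qed.

Lemma neighboursM (c : fps rat) Y k :
  neighbours (fun j => c * Y j) k = c * neighbours Y k.
Proof. by rewrite /neighbours; case: k => [|k]; ring. Qed.

Lemma neighbours_ext Y Y' k : Y =1 Y' -> neighbours Y k = neighbours Y' k.
Proof. by rewrite /neighbours; case: k => [|k] YY; rewrite !YY. Qed.

(** The factor x makes coefficient n + 1 depend on coefficients n only, so induction on n works for
    all heights at once. *)
Lemma neighbours_unique (g : nat -> fps rat) Y Y' :
    (forall k, Y k = g k + 'x * neighbours Y k) ->
    (forall k, Y' k = g k + 'x * neighbours Y' k) ->
  forall k, Y k = Y' k.
Proof.
move=> YE Y'E k; apply/funext => n; elim: n k => [|n IH] k.
  by rewrite YE Y'E !fpsD !fps_mulX0.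
rewrite YE Y'E !fpsD !fps_mulXS; congr (_ + _); rewrite /neighbours !fpsD !IH.
by case: k => [|k]; rewrite ?IH.
Qed.

Definition w_count (l : seq nat) : rat := 1.
Definition w_points (l : seq nat) : rat := (size l)%:R.
Definition w_area (l : seq nat) : rat := (sumn l)%:R.
Definition w_sumsq (l : seq nat) : rat := (sumsq l)%:R.
(* Twice the size of the core with runner heights l, see [psize_beads]. *)
Definition w_size2 (l : seq nat) : rat :=
  (size l)%:R * (sumsq l)%:R - ((size l)%:R - 1) * (sumn l)%:R
    + 2 * (moment l)%:R - (sumn l)%:R ^+ 2.

Lemma gf_count k : path_gf w_count k =
  (k == 0%N)%:R + 'x * neighbours (path_gf w_count) k.
Proof.
rewrite path_gf_rec; congr (_ + _).
by case: eqP => _; rewrite ?raddf0 // rmorph1.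
Qed.

(** Prepending a point adds 1 for each path; together with the one-point path these ones reassemble
    into [path_gf w_count k]. *)
Lemma gf_points k : path_gf w_points k =
  path_gf w_count k + 'x * neighbours (path_gf w_points) k.
Proof.
rewrite path_gf_rec gf_count -addrA -mulrDr -neighboursD; congr (_ + _ * _).
  by case: eqP => _; rewrite ?raddf0 // rmorph1.
apply: neighbours_ext => j; rewrite -path_gfD; apply: path_gf_ext => l /=.
by rewrite /w_points /w_count /= -natr1 addrC.
Qed.

Lemma natr_delta k (f : fps rat) : k%:R * ((k == 0)%:R + f) = k%:R * f.
Proof. by case: k => [|k]; rewrite ?mul0r // add0r. Qed.

Lemma gf_area k : path_gf w_area k =
  k%:R * path_gf w_count k + 'x * neighbours (path_gf w_area) k.
Proof.
rewrite path_gf_rec0 // gf_count natr_delta mulrCA -mulrDr; congr (_ * _).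
rewrite -neighboursM -neighboursD.
apply: neighbours_ext => j; rewrite -path_gfM -path_gfD; apply: path_gf_ext => l /=.
by rewrite /w_area /w_count /= natrD mulr1.
Qed.

Lemma gf_sumsq k : path_gf w_sumsq k =
  k%:R ^+ 2 * path_gf w_count k + 'x * neighbours (path_gf w_sumsq) k.
Proof.
rewrite path_gf_rec0; last by rewrite /w_sumsq /sumsq big_ord1.
rewrite gf_count expr2 -mulrA natr_delta !(mulrCA _ 'x) -mulrDr; congr (_ * _).
rewrite -!neighboursM -neighboursD.
apply: neighbours_ext => j; rewrite -!path_gfM -path_gfD; apply: path_gf_ext => l /=.
by rewrite /w_sumsq /w_count sumsq_cons natrD natrX; ring.
Qed.

Lemma gf_size2 k : path_gf w_size2 k =
  path_gf w_sumsq k + (1 - 2 * k%:R) * path_gf w_area k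
  + (k%:R ^+ 2 - k%:R) * path_gf w_points k + 'x * neighbours (path_gf w_size2) k.
Proof.
(* The nonlinear terms are absorbed into [w_size2 l]; the increment is linear in the other
   statistics, so the system closes. *)
have step l : w_size2 (k :: l) =
    w_size2 l + w_sumsq l + w_area l + (- ((2 * k)%N%:R * w_area l))
      + (k ^ 2)%N%:R * w_points l + (- (k%:R * w_points l)).
  rewrite /w_size2 /w_sumsq /w_area /w_points sumsq_cons moment_cons /=.
  by rewrite (natrM _ 2 k) natrD (natrX _ k 2) natrD -natr1; ring.
rewrite path_gf_rec0; last first.
  by rewrite /w_size2 /sumsq /moment !big_ord1.
have stepj : path_gf (w_size2 \o cons k) =1 fun j =>
    path_gf w_size2 j + path_gf w_sumsq j + path_gf w_area j
      + (- ((2 * k)%N%:R * path_gf w_area j))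
      + (k ^ 2)%N%:R * path_gf w_points j + (- (k%:R * path_gf w_points j)).
  by move=> j; rewrite (path_gf_ext _ step) !path_gfD !path_gfN !path_gfM.
rewrite (neighbours_ext k stepj) !(neighboursD, neighboursN, neighboursM).
rewrite (natrM _ 2 k) (natrX _ k 2).
rewrite gf_sumsq gf_area gf_points.
(* The count drops out: k^2 + (1 - 2k) k + (k^2 - k) = 0. *)
set C := path_gf w_count k; ring.
Qed.

End GeneratingFunctions.

(** * Polynomial solutions of the transferred systems *)

Section ClosedForms.
Local Open Scope ring_scope.
Variables (R : comNzRingType) (r e : R).
Let M := 1 + r + r ^+ 2.
Let a := 1 + r ^+ 2.
Let d := 1 - r ^+ 2.

(* [transfer p K = M * g K] says that [p k * r ^ k] solves the system with
   inhomogeneous term [g k * r ^ k]; the condition at [k = 0] is [p (-1) = 0].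
   The [pol_*] below were found by solving for the coefficients degree by degree;
   they are homogenized by [e = 1 / d], and the numeric suffix is the factor that
   clears denominators ([pol_size24] belongs to 12 times the doubled size). *)
Definition transfer (p : R -> R) (K : R) :=
  (1 + r ^+ 2) * p K - p (K - 1) - r ^+ 2 * p (K + 1).

Definition pol_points (K : R) := M ^+ 2 * e * (K + 1).
Definition pol_area2 (K : R) := M ^+ 2 * e ^+ 2 * (K + 1) * (d * K + 2 * r ^+ 2).
Definition pol_sumsq6 (K : R) := M ^+ 2 * e ^+ 3 *
  (2 * d ^+ 2 * K ^+ 3 + 3 * a * d * K ^+ 2
   + (3 * a ^+ 2 - 2 * d ^+ 2) * K + 3 * a ^+ 2 - 3 * a * d).
Definition pol_size24 (K : R) := M ^+ 3 * e ^+ 5 *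
  (d ^+ 3 * K ^+ 4 + 2 * d ^+ 3 * K ^+ 3 + (3 * a ^+ 2 * d - 4 * d ^+ 3) * K ^+ 2
   + (6 * a ^+ 2 * d - 8 * d ^+ 3 - 3 * a * d ^+ 2 + 3 * a ^+ 3) * K + 24 * r ^+ 2).

Hypothesis ed : e * (1 - r ^+ 2) = 1.

(** Inserting a power of [e * d] = 1 balances the powers of [e]; what remains is a polynomial
    identity. The next lemmas follow the same pattern. *)
Lemma transfer_points K : transfer pol_points K = M * M.
Proof.
transitivity (M * M * (e * d)); last by rewrite ed mulr1.
rewrite /transfer /pol_points /d /M; ring.
Qed.

Lemma transfer_area2 K : transfer pol_area2 K = M * (2 * K * M).
Proof.
transitivity (M * (2 * K * M) * (e * d) ^+ 2); last by rewrite ed expr1n mulr1.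
rewrite /transfer /pol_area2 /d /M; ring.
Qed.

Lemma transfer_sumsq6 K : transfer pol_sumsq6 K = M * (6 * K ^+ 2 * M).
Proof.
transitivity (M * (6 * K ^+ 2 * M) * (e * d) ^+ 3); last by rewrite ed expr1n mulr1.
rewrite /transfer /pol_sumsq6 /a /d /M; ring.
Qed.

Lemma transfer_size24 K : transfer pol_size24 K =
  M * (2 * pol_sumsq6 K + 6 * (1 - 2 * K) * pol_area2 K
       + 12 * (K ^+ 2 - K) * pol_points K).
Proof.
(* The exponents 2, 3, 4 raise the factors e^3, e^2, e to the e^5 of [pol_size24]. *)
transitivity (M * (2 * pol_sumsq6 K * (e * d) ^+ 2
    + 6 * (1 - 2 * K) * pol_area2 K * (e * d) ^+ 3
    + 12 * (K ^+ 2 - K) * pol_points K * (e * d) ^+ 4)); last first.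
  by rewrite ed !expr1n !mulr1.
rewrite /transfer /pol_size24 /pol_sumsq6 /pol_area2 /pol_points /a /d /M; ring.
Qed.

End ClosedForms.

(** * Closed forms of the generating functions *)

Section Solution.
Local Open Scope ring_scope.
Local Notation "'x" := (fpsX rat).
Variables r e i : fps rat.
Local Notation M := (1 + r + r ^+ 2).
Hypothesis rE : r = 'x * M.
Hypothesis iM : i * M = 1.
Hypothesis ed : e * (1 - r ^+ 2) = 1.

Lemma fpsX_ratio : 'x = r * i.
Proof. by rewrite {1}rE -mulrA (mulrC M) iM mulr1. Qed.

(** After multiplication by M, with x M = r, the coefficient of p(k) r^k is M - r = 1 + r^2, which
    gives [transfer]; p(-1) = 0 stands in for the missing neighbour of height 0. *)
Lemma transfer_solution (p g : fps rat -> fps rat) :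
    p (- 1) = 0 -> (forall K, transfer r p K = M * g K) ->
  forall k : nat, p k%:R * r ^+ k =
    g k%:R * r ^+ k + 'x * neighbours (fun j => p j%:R * r ^+ j) k.
Proof.
move=> p0 pg k.
have gE K : g K = i * transfer r p K by rewrite pg mulrA iM mul1r.
rewrite gE fpsX_ratio /neighbours /transfer; transitivity (i * M * (p k%:R * r ^+ k)).
  by rewrite iM mul1r.
case: k => [|k].
  by rewrite mulr0n sub0r add0r p0 mulr1n expr0 expr1; ring.
rewrite -!natr1 addrK !exprS; ring.
Qed.

(** The constant p = M violates p(-1) = 0, which matches the source term at k = 0 only; hence a
    direct check from x M = r. *)
Lemma gf_countE k : path_gf w_count k = M * r ^+ k.
Proof.
apply: (neighbours_unique (Y' := fun k => M * r ^+ k) gf_count) => {}k; rewrite /neighbours.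
case: k => [|k].
  by rewrite add0r -mulrDr mulrA -rE !expr0 expr1 eqxx /= mulr1n; ring.
by rewrite -!mulrDr mulrA -rE !exprS mulr0n; ring.
Qed.

Lemma gf_pointsE k : path_gf w_points k = pol_points r e k%:R * r ^+ k.
Proof.
apply: (neighbours_unique (Y' := fun k => pol_points r e k%:R * r ^+ k) gf_points) => {}k.
rewrite gf_countE; apply: (transfer_solution (g := fun=> M)).
  by rewrite /pol_points addNr mulr0.
by move=> K; rewrite transfer_points.
Qed.

Lemma gf_area2E k : 2 * path_gf w_area k = pol_area2 r e k%:R * r ^+ k.
Proof.
apply: (@neighbours_unique (fun k => 2 * (k%:R * path_gf w_count k))
  (fun k => 2 * path_gf w_area k) (fun k => pol_area2 r e k%:R * r ^+ k)) => {}k.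
  by rewrite gf_area mulrDr neighboursM (mulrCA 'x).
rewrite gf_countE !mulrA.
apply: (transfer_solution (g := fun K => 2 * K * M)).
  by rewrite /pol_area2 addNr mulr0 mul0r.
by move=> K; rewrite transfer_area2.
Qed.

Lemma gf_sumsq6E k : 6 * path_gf w_sumsq k = pol_sumsq6 r e k%:R * r ^+ k.
Proof.
apply: (@neighbours_unique (fun k => 6 * (k%:R ^+ 2 * path_gf w_count k))
  (fun k => 6 * path_gf w_sumsq k) (fun k => pol_sumsq6 r e k%:R * r ^+ k)) => {}k.
  by rewrite gf_sumsq mulrDr neighboursM (mulrCA 'x).
rewrite gf_countE (mulrA _ M) (mulrA 6).
apply: (transfer_solution (g := fun K => 6 * (K ^+ 2 * M))).
  by rewrite /pol_sumsq6; ring.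
by move=> K; rewrite transfer_sumsq6 // (mulrA 6).
Qed.

Lemma gf_size24E k : 12 * path_gf w_size2 k = pol_size24 r e k%:R * r ^+ k.
Proof.
pose g K := 2 * pol_sumsq6 r e K + 6 * (1 - 2 * K) * pol_area2 r e K
       + 12 * (K ^+ 2 - K) * pol_points r e K.
apply: (@neighbours_unique (fun k => g k%:R * r ^+ k)
  (fun k => 12 * path_gf w_size2 k) (fun k => pol_size24 r e k%:R * r ^+ k)) => {}k.
  rewrite gf_size2 mulrDr neighboursM (mulrCA 'x); congr (_ + _).
  transitivity (2 * (pol_sumsq6 r e k%:R * r ^+ k)
    + 6 * (1 - 2 * k%:R) * (pol_area2 r e k%:R * r ^+ k)
    + 12 * (k%:R ^+ 2 - k%:R) * (pol_points r e k%:R * r ^+ k)); last first.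
    by rewrite /g; ring.
  by rewrite -gf_sumsq6E -gf_area2E -gf_pointsE; ring.
apply: transfer_solution.
  by rewrite /pol_size24; ring.
by move=> K; rewrite transfer_size24.
Qed.

Lemma gf_size2E : path_gf w_size2 0 = 2 * ('x * ('x * (M * e) ^+ 5)).
Proof.
have xM : 'x ^+ 2 * M ^+ 2 = r ^+ 2 by rewrite -exprMn -rE.
have H : 12 * path_gf w_size2 0 = 12 * (2 * ('x * ('x * (M * e) ^+ 5))).
  (* At k = 0, [pol_size24] is 24 r^2 M^3 e^5. The factor 12 is then cancelled coefficientwise, in
     the rationals. *)
  transitivity (24 * M ^+ 3 * e ^+ 5 * ('x ^+ 2 * M ^+ 2)); last by ring.
  by rewrite gf_size24E xM /pol_size24 mulr0n expr0; ring.
apply/funext => n; move: (congr1 (fun f : fps rat => f n) H).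
by rewrite !fps_natl => /mulfI -> //.
Qed.

(** With x = r / M, the numerator is M^2 - 2 r M - 3 r^2 = (M + r)(M - 3 r) = (1 + r)^2 (1 -
    r)^2. *)
Lemma discriminantE : fps_of_poly Pbase = ((1 - r ^+ 2) * i) ^+ 2.
Proof.
rewrite /Pbase !rmorphB rmorph1 -!mul_polyC !rmorphM /= -/'x.
rewrite !polyC_natr !rmorph_nat fpsX_ratio.
transitivity ((i * M) ^+ 2 - 2 * (r * i) * (i * M) - 3 * (r * i) ^+ 2).
  by rewrite iM expr1n mulr1 expr2.
ring.
Qed.

End Solution.

(** * Summing the doubled size over all Motzkin paths *)

Section MotzkinSize.
Local Open Scope ring_scope.

Lemma motzkin_size2_gf : exists F : nat -> rat, is_pow_m5half F /\
  forall s, (\sum_(l <- motzkin s 0) w_size2 l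
    = if (s < 2)%N then 0 else 2 * F (s - 2)%N)%R.
Proof.
have [r rE] := motzkin_series.
(* Since x M = r, the two arguments are chosen so that 1 - x f becomes 1 + r + r^2 here and 1 - r^2
   next. *)
have [i iM] := fps_inv1X (- (1 + r + r ^+ 2) * (1 + r)).
have [e ed] := fps_inv1X (r * (1 + r + r ^+ 2)).
have {}iM : i * (1 + r + r ^+ 2) = 1.
  by rewrite -[RHS]iM; congr (_ * _); rewrite mulrA mulrN -rE; ring.
have {}ed : e * (1 - r ^+ 2) = 1.
  by rewrite -[RHS]ed; congr (_ * _); rewrite mulrCA -rE; ring.
have r0 : r 0 = 0 by rewrite rE fps_mulX0.
have M0 : (1 + r + r ^+ 2) 0 = 1.
  by rewrite !fpsD fps1 fpsX0 r0 expr0n !addr0.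
have e0 : e 0 = 1.
  move: (congr1 (fun f : fps rat => f 0) ed).
  by rewrite fpsM0 fpsD fpsN fpsX0 r0 fps1 expr0n subr0 mulr1.
pose F : fps rat := ((1 + r + r ^+ 2) * e) ^+ 5; exists F; split; last first.
  move=> s; have := congr1 (fun f : fps rat => f s) (gf_size2E rE iM ed).
  rewrite /path_gf fps_natl => ->.
  by case: s => [|[|s]]; rewrite ?fps_mulXS ?fps_mulX0 ?mulr0 // subn2.
split; first by rewrite /F fpsX0 fpsM0 M0 e0 mulr1 expr1n.
move=> n; transitivity ((F * (F * fps_of_poly (Pbase ^+ 5))) n).
  rewrite [RHS]fpsM; apply: eq_bigr => j _.
  rewrite fpsM mulr_sumr; apply: eq_bigr => k _; rewrite mulrA; congr (_ * _).
rewrite -fps1; congr (fun f : fps rat => f n).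
rewrite rmorphXn /= (discriminantE rE iM) /F.
(* F^2 contributes (M e)^10 and the fifth power of the discriminant contributes ((1 - r^2) i)^10. *)
transitivity ((i * (1 + r + r ^+ 2)) ^+ 10 * (e * (1 - r ^+ 2)) ^+ 10); first ring.
by rewrite iM ed !expr1n mulr1.
Qed.

End MotzkinSize.

(** * Cores, beta-sets and abaci *)

Local Arguments conj_part : simpl never.

(* The first-column hook lengths, in decreasing order. *)
Fixpoint beta (la : seq nat) : seq nat :=
  if la is a :: la' then (a + size la') :: beta la' else [::].

Fixpoint unbeta (X : seq nat) : seq nat :=
  if X is x :: X' then (x - size X') :: unbeta X' else [::].

(** The case x = t would put 0 into X, so for a beta-set, which avoids 0, closure also excludes t
    itself. *)
Definition closed_sub (t : nat) (X : seq nat) : Prop :=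
  forall x, x \in X -> t <= x -> x - t \in X.

Lemma is_partition_cons a la :
  is_partition (a :: la) = [&& 0 < a, all (geq a) la & is_partition la].
Proof.
have geq_trans : transitive geq by move=> x y z; rewrite /= => ? /leq_trans; apply.
rewrite /is_partition /= path_sortedE //.
by case: (0 < a); case: (all _ la); case: (sorted _ la); rewrite ?andbF.
Qed.

Lemma size_beta la : size (beta la) = size la.
Proof. by elim: la => //= a la ->. Qed.

Lemma size_unbeta X : size (unbeta X) = size X.
Proof. by elim: X => //= x X ->. Qed.

Lemma betaK : cancel beta unbeta.
Proof. by elim=> //= a la ->; rewrite size_beta addnK. Qed.

Lemma nth_beta la i : i < size la ->
  nth 0 (beta la) i = nth 0 la i + (size la - i.+1).
Proof. by elim: la i => //= a la IH [|i] lt_i /=; rewrite ?subSS ?subn0 ?IH. Qed.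

Lemma conj_part_cons a la j : conj_part (a :: la) j = (j < a) + conj_part la j.
Proof. by []. Qed.

Lemma conj_part_eq0 a la j : all (geq a) la -> a <= j -> conj_part la j = 0.
Proof.
move=> /allP le_a le_aj; apply/eqP; rewrite -leqn0 leqNgt -has_count.
by apply/hasPn => x /le_a /= le_xa; rewrite -leqNgt; lia.
Qed.

Lemma ltn_conj_part la i j : is_partition la ->
  (i < conj_part la j) = (j < nth 0 la i).
Proof.
elim: la i => [|a la IH] i; first by rewrite nth_nil.
rewrite is_partition_cons conj_part_cons => /and3P[_ le_a /IH {}IH].
case: (ltnP j a) => [lt_ja|le_aj]; first by case: i => [|i] /=; rewrite -?IH //; lia.
have c0 := conj_part_eq0 le_a le_aj.
by case: i => [|i] /=; rewrite -?IH c0; lia.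
Qed.

(* The hooks of row i are the differences x_i - y, y < x_i outside the beta-set;
   the y attached to column j is j + size la - conj_part la j. *)
Lemma notin_beta la y : is_partition la ->
  y \notin beta la <-> exists j, y + conj_part la j = j + size la.
Proof.
elim: la y => [|a la IH] y; first by split=> // _; exists y.
rewrite is_partition_cons => /and3P[_ le_a /IH {}IH] /=.
rewrite inE negb_or; split.
  case/andP=> /eqP ney /IH[j jE].
  case: (ltnP j a) => [lt_ja|le_aj].
    by exists j; rewrite conj_part_cons lt_ja; lia.
  have c0 := conj_part_eq0 le_a le_aj; rewrite c0 in jE.
  exists j.-1; rewrite conj_part_cons (conj_part_eq0 le_a) //; lia.
case=> j; rewrite conj_part_cons; case: (ltnP j a) => [lt_ja|le_aj] jE.
  have jE' : y + conj_part la j = j + size la by lia.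
  apply/andP; split; last by apply/IH; exists j.
  by have := count_size (fun x => j < x) la; rewrite -/(conj_part la j); lia.
have c0 := conj_part_eq0 le_a le_aj.
apply/andP; split; first by lia.
by apply/IH; exists j.+1; rewrite (conj_part_eq0 le_a) //; lia.
Qed.

(** A missing x - t would make t a hook length. Conversely a hook length q t is x - y with y
    missing, yet subtracting t from x q times stays in the set. *)
Lemma core_closed_sub t la : is_partition la ->
  (forall i j, in_diagram la i j -> ~~ (t %| hook la i j)) <->
  closed_sub t (beta la).
Proof.
move=> la_part; split=> [core_la x xB le_tx|closedB i j lt_j].
  apply/negPn/negP => /(notin_beta _ la_part)[j jE].
  have lt_i : index x (beta la) < size la by rewrite -size_beta index_mem.
  have xE : x = nth 0 (beta la) (index x (beta la)) by rewrite nth_index.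
  set i := index x (beta la) in lt_i xE; rewrite nth_beta // in xE.
  have conjE := ltn_conj_part i j la_part.
  have lt_j : j < nth 0 la i.
    by case: (ltnP j) conjE => // le_j; lia.
  have := core_la i j lt_j; rewrite lt_j in conjE.
  by rewrite (_ : hook la i j = t) ?dvdnn // /hook; lia.
apply/negP => /dvdnP[q hE].
have lt_i : i < size la.
  by rewrite ltnNge; apply/negP => ge_i; move: lt_j; rewrite /in_diagram nth_default.
have lt_c : i < conj_part la j by rewrite ltn_conj_part.
have le_c : conj_part la j <= size la by apply: count_size.
pose x := nth 0 (beta la) i.
have xB : x \in beta la by rewrite mem_nth ?size_beta.
have xE : x = nth 0 la i + (size la - i.+1) by rewrite /x nth_beta.
have iterB p : p * t <= x -> x - p * t \in beta la.
  elim: p => [|p IHp]; first by rewrite subn0.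
  rewrite mulSn => le_x; rewrite addnC subnDA; apply: closedB; first by apply: IHp; lia.
  lia.
rewrite /in_diagram in lt_j; rewrite /hook in hE.
have yB : x - q * t \in beta la by apply: iterB; lia.
have : x - q * t \notin beta la by apply/notin_beta => //; exists j; lia.
by rewrite yB.
Qed.

Lemma beta_sorted la : is_partition la -> sorted gtn (beta la).
Proof.
elim: la => // a la IH; rewrite is_partition_cons => /and3P[_ le_a /IH] /=.
by case: la le_a {IH} => //= b la /andP[le_ba _] ->; rewrite andbT /=; lia.
Qed.

Lemma beta_gt0 la : is_partition la -> 0 \notin beta la.
Proof.
elim: la => // a la IH; rewrite is_partition_cons inE negb_or => /and3P[a0 _ /IH ->].
by rewrite andbT; lia.
Qed.

(** This makes the truncated subtractions of [unbeta] exact and its parts positive. *)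
Lemma sorted_gtn_size X : sorted gtn X -> 0 \notin X -> size X <= head 0 X.
Proof.
elim: X => // x [|y X] IH /=; first by rewrite inE; lia.
move=> /andP[lt_yx sX]; rewrite inE negb_or => /andP[_ n0].
by have := IH sX n0; rewrite /= in lt_yx *; lia.
Qed.

Lemma unbetaK X : sorted gtn X -> 0 \notin X ->
  is_partition (unbeta X) /\ beta (unbeta X) = X.
Proof.
elim: X => // x X IH sX n0.
have := sorted_gtn_size sX n0; rewrite /= => le_x.
have [] := IH (path_sorted sX); first by move: n0; rewrite inE negb_or => /andP[].
move=> pX bX; rewrite size_unbeta bX subnK; last by lia.
split=> //; rewrite is_partition_cons subn_gt0 le_x pX andbT /=.
case: X sX pX {IH n0 le_x bX} => //= y X /andP[lt_yx _].
rewrite -/(unbeta (y :: X)) is_partition_cons => /and3P[_ /allP le_y _].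
have le_yx : y - size X <= x - (size X).+1 by rewrite /= in lt_yx; lia.
by rewrite le_yx; apply/allP => z /le_y /= le_z; apply: leq_trans le_yx.
Qed.

(** For n parts the shifts 0, ..., n - 1 add n(n - 1)/2; the form avoids division and
    subtraction. *)
Lemma sumn_beta la : 2 * sumn (beta la) + size la = 2 * psize la + size la ^ 2.
Proof. by rewrite /psize; elim: la => //= a la IH; rewrite -addn1; nia. Qed.

(** * Abaci with s + 1 runners *)

(* Runner [i] of the abacus holds the positions [q * s.+1 + i] with [q < nth 0 m i]. *)
Definition beads (s : nat) (m : seq nat) : seq nat :=
  [seq x <- rev (iota 0 (sumn m * s.+1)) | x %/ s.+1 < nth 0 m (x %% s.+1)].

(** Ensures that cutting [beads] at [sumn m] rows loses no bead. *)
Lemma leq_nth_sumn m i : nth 0 m i <= sumn m.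
Proof. by elim: m i => [|a m IH] [|i] //=; [lia | have := IH i; lia]. Qed.

Lemma mem_beads s m x : (x \in beads s m) = (x %/ s.+1 < nth 0 m (x %% s.+1)).
Proof.
rewrite mem_filter mem_rev mem_iota /= add0n -ltn_divLR //.
by case: (ltnP (x %/ s.+1) (nth 0 m _)) => //= /leq_trans -> //; apply: leq_nth_sumn.
Qed.

Lemma beads_sorted s m : sorted gtn (beads s m).
Proof.
apply: sorted_filter; first by move=> x y z /= ? /ltn_trans; apply.
by rewrite rev_sorted; apply: iota_ltn_sorted.
Qed.

Lemma sum_nat_mul (f : nat -> nat) n B :
  \sum_(0 <= x < B * n) f x = \sum_(q < B) \sum_(i < n) f (q * n + i).
Proof.
elim: B => [|B IH]; first by rewrite big_ord0 big_geq.
rewrite big_ord_recr -IH /= mulSn addnC (big_cat_nat (n := B * n)) //=; last by lia.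
congr (_ + _); rewrite -{1}[B * n]add0n big_addn addKn big_mkord.
by apply: eq_bigr => i _; rewrite addnC.
Qed.

Lemma sum_beads (f : nat -> nat) s m :
  \sum_(x <- beads s m) f x =
  \sum_(i < s.+1) \sum_(q < nth 0 m i) f (q * s.+1 + i).
Proof.
rewrite big_filter (perm_big (iota 0 (sumn m * s.+1))) /=; last by rewrite perm_rev.
rewrite big_mkcond /= -[iota _ _]/(iota 0 _) -{1}[sumn m * s.+1]subn0 sum_nat_mul.
rewrite exchange_big /=; apply: eq_bigr => i _.
rewrite (big_ord_widen _ (fun q => f (q * s.+1 + i)) (leq_nth_sumn m i)) [RHS]big_mkcond.
apply: eq_bigr => q _.
by rewrite divnMDl // modnMDl modn_small // divn_small // addn0.
Qed.

Lemma size_beads s m : size m = s.+1 -> size (beads s m) = sumn m.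
Proof.
move=> size_m; rewrite -sum1_size sum_beads sumn_nth size_m.
by apply: eq_bigr => i _; rewrite sum1_card card_ord.
Qed.

(** Runner i with h beads contributes (s + 1) h (h - 1)/2 + i h. *)
Lemma sumn_beads s m : size m = s.+1 ->
  2 * sumn (beads s m) + s.+1 * sumn m = s.+1 * sumsq m + 2 * moment m.
Proof.
move=> size_m; rewrite sumnE sum_beads sumn_nth /sumsq /moment size_m.
rewrite !big_distrr -!big_split; apply: eq_bigr => i _ /=.
by elim: (nth 0 m i) => [|k IH]; [rewrite big_ord0; lia | rewrite big_ord_recr /=; nia].
Qed.

(** Eliminating the sum of the beads between [sumn_beta], for [sumn m] parts, and [sumn_beads]
    produces the formula of [w_size2]. *)
Lemma psize_beads s m : size m = s.+1 -> 0 \notin beads s m ->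
  (2 * (psize (unbeta (beads s m)))%:R = w_size2 m)%R.
Proof.
move=> size_m n0; have [_ bX] := unbetaK (beads_sorted s m) n0.
have sizeE := sumn_beta (unbeta (beads s m)).
rewrite bX size_unbeta size_beads // in sizeE.
have {}sizeE : (2 * (sumn (beads s m))%:R + (sumn m)%:R
    = 2 * (psize (unbeta (beads s m)))%:R + (sumn m)%:R ^+ 2 :> rat)%R.
  by rewrite -natrX -!natrM -!natrD sizeE.
have sumE : (2 * (sumn (beads s m))%:R + (size m)%:R * (sumn m)%:R
    = (size m)%:R * (sumsq m)%:R + 2 * (moment m)%:R :> rat)%R.
  by rewrite -!natrM -!natrD size_m sumn_beads.
by rewrite /w_size2; lra.
Qed.

(** * Motzkin paths as runner heights *)

Lemma mem_motzkin n k l : reflect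
  [/\ size l = n.+1, nth 0 l 0 = k, nth 0 l n = 0 &
      forall i, i < n -> nth 0 l i <= (nth 0 l i.+1).+1 /\ nth 0 l i.+1 <= (nth 0 l i).+1]
  (l \in motzkin n k).
Proof.
elim: n k l => [|n IH] k l.
  apply: (iffP idP).
    by case: k => // /[!inE] /eqP ->; split.
  by case: l => [|a [|b l]] [] //= _ <- ->.
apply: (iffP mapP) => [[l' l'P ->] | [size_l <- last_l step_l]].
  suff [j [adj l'j]] : exists j, (k <= j.+1 /\ j <= k.+1) /\ l' \in motzkin n j.
    have [size_l' hd_l' last_l' step_l'] := IH j l' l'j.
    split=> //=; first by rewrite size_l'.
    by case=> [|i] lt_i /=; [rewrite hd_l' | apply: step_l'].
  move: l'P; rewrite !mem_cat => /orP[|/orP[]].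
  - by case: k => // k l'P; exists k; split=> //; lia.
  - by move=> l'P; exists k; split=> //; lia.
  - by move=> l'P; exists k.+1; split=> //; lia.
case: l size_l last_l step_l => //= {}k l' [size_l'] last_l step_l.
exists l' => //; rewrite !mem_cat.
have l'P : l' \in motzkin n (nth 0 l' 0).
  by apply/IH; split=> // i lt_i; apply: (step_l i.+1).
have /= [le1 le2] := step_l 0 isT.
have [jE|[jE|jE]] : (nth 0 l' 0 = k.-1 /\ 0 < k) \/ nth 0 l' 0 = k \/ nth 0 l' 0 = k.+1.
  by lia.
- by case: k jE {step_l le1 le2} => [|k] [/= jE] // _; rewrite -jE l'P.
- by rewrite -jE l'P orbT.
- by rewrite -jE l'P !orbT.
Qed.

(** The three pieces of the recursion are disjoint because their paths start at different
    heights. *)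
Lemma motzkin_uniq n k : uniq (motzkin n k).
Proof.
elim: n k => [|n IH] k; first by case: k.
rewrite /= map_inj_uniq; last by move=> l l' [].
have disj j j' : j != j' -> ~~ has [in motzkin n j] (motzkin n j').
  move=> /eqP ne_j; apply/hasPn => l /mem_motzkin[_ hd _ _].
  by apply/negP => /mem_motzkin[_ hd' _ _]; apply: ne_j; rewrite -hd -hd'.
have disj0 : ~~ has [in motzkin n k] (motzkin n k.+1) by apply: disj; lia.
rewrite cat_uniq [uniq (_ ++ motzkin _ k.+1)]cat_uniq !IH disj0 /= andbT.
case: k {disj0} => [|k]; first by rewrite /= -all_predC all_predT.
rewrite IH has_cat negb_or !disj //; lia.
Qed.

(** Subtracting s, s + 1 or s + 2 moves a bead one row down and one runner right, none, or one
    left. *)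
Lemma closed_sub_heights s X m : size m = s.+1 ->
    (forall q i, i <= s -> (q * s.+1 + i \in X) = (q < nth 0 m i)) ->
  [/\ 0 \notin X, closed_sub s X, closed_sub s.+1 X & closed_sub s.+2 X]
  <-> m \in motzkin s 0.
Proof.
move=> size_m XE.
have XE' x q i : i <= s -> x = q * s.+1 + i -> (x \in X) = (q < nth 0 m i).
  by move=> le_i ->; apply: XE.
split=> [[n0 c0 c1 c2]|/mem_motzkin[_ m0 ms step_m]].
  apply/mem_motzkin; split=> //.
  - apply/eqP; rewrite eqn0Ngt; apply/negP => m0.
    by case/negP: n0; rewrite (XE' 0 0 0).
  - apply/eqP; rewrite eqn0Ngt; apply/negP => ms.
    (* The lowest bead of runner s is the position s, and s - s = 0. *)
    case/negP: n0; rewrite -(subnn s); apply: c0 => //.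
    by rewrite (XE' s 0 s).
  - move=> i lt_i; split; rewrite leqNgt; apply/negP => lt_m.
      (* If runner i were too high, this bead would move to the first empty row of runner i + 1;
         [c2] serves symmetrically below. *)
      have := c0 ((nth 0 m i.+1).+1 * s.+1 + i).
      rewrite XE ?lt_m; last by lia.
      rewrite (XE' _ (nth 0 m i.+1) i.+1) ?ltnn //; last by lia.
      by move=> H; suff : false by []; apply: H => //; lia.
    have := c2 ((nth 0 m i).+1 * s.+1 + i.+1).
    rewrite XE ?lt_m; last by lia.
    rewrite (XE' _ (nth 0 m i) i) ?ltnn //; [|lia|lia].
    by move=> H; suff : false by []; apply: H => //; lia.
have decomp x : x \in X -> exists q i, [/\ x = q * s.+1 + i, i <= s & q < nth 0 m i].
  move=> xX; exists (x %/ s.+1), (x %% s.+1).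
  have le_i : x %% s.+1 <= s by rewrite -ltnS ltn_mod.
  by rewrite -(XE _ _ le_i) -divn_eq.
split; first by rewrite (XE' 0 0 0) // m0.
- move=> x /decomp[q [i [xE le_i lt_q]]] le_x.
  (* Runner s is empty, so subtracting s never wraps around; the empty runner 0 plays this part for
     s + 2. *)
  have ne_i : i <> s by move=> iE; rewrite iE ms in lt_q.
  have lt_i : i < s by lia.
  have [le1 _] := step_m i lt_i.
  have q0 : 0 < q by case: q xE {lt_q} => // xE; lia.
  rewrite (XE' _ q.-1 i.+1) //; first by lia.
  by case: q xE q0 {lt_q} => // q -> _ /=; lia.
- move=> x /decomp[q [i [xE le_i lt_q]]] le_x.
  have q0 : 0 < q by case: q xE {lt_q} => // xE; lia.
  rewrite (XE' _ q.-1 i) //; first by lia.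
  by case: q xE q0 {lt_q} => // q -> _ /=; lia.
- move=> x /decomp[q [i [xE le_i lt_q]]] le_x.
  case: i xE le_i lt_q => [|i] xE lt_i lt_q; first by rewrite m0 in lt_q.
  have [_ le2] := step_m i lt_i.
  have q0 : 0 < q by case: q xE {lt_q} => // xE; lia.
  rewrite (XE' _ q.-1 i) //; [by lia|by lia|].
  by case: q xE q0 {lt_q} => // q -> _ /=; lia.
Qed.

(** The height is the first empty row: closure under s + 1 forbids beads above it. *)
Lemma runner_heights s X : closed_sub s.+1 X ->
  exists2 m, size m = s.+1 &
    forall q i, i <= s -> (q * s.+1 + i \in X) = (q < nth 0 m i).
Proof.
move=> cX.
have ex i : exists q, q * s.+1 + i \notin X.
  (* A position in this row exceeds the sum of X, hence every element of X. *)
  exists (sumn X).+1; apply/negP => xX.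
  have := leq_nth_sumn X (index ((sumn X).+1 * s.+1 + i) X).
  by rewrite nth_index //; lia.
exists (mkseq (fun i => ex_minn (ex i)) s.+1) => [|q i le_i]; first by rewrite size_mkseq.
rewrite nth_mkseq //; case: ex_minnP => h hX h_min.
case: ltnP => [lt_q|le_h].
  by apply/negPn/negP => /h_min; lia.
apply/negbTE; elim: q le_h => [|q IH] le_h; first by case: h hX le_h {h_min}.
case: (ltnP q h) => [lt_h|/IH]; first by have <- : h = q.+1 by lia.
apply: contra => /cX; rewrite (_ : _ - _ = q * s.+1 + i); last by lia.
by apply; lia.
Qed.

Lemma mem_beads_runner s m q i : i <= s ->
  (q * s.+1 + i \in beads s m) = (q < nth 0 m i).
Proof.
by move=> le_i; rewrite mem_beads divnMDl // modnMDl modn_small // divn_small // addn0.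
Qed.

Lemma beads_inj s : {in motzkin s 0 &, injective (beads s)}.
Proof.
move=> m m' /mem_motzkin[size_m _ _ _] /mem_motzkin[size_m' _ _ _] eq_b.
apply: (@eq_from_nth _ 0); first by rewrite size_m'.
rewrite size_m => i le_i; apply/eqP; rewrite eqn_leq.
have H q : (q < nth 0 m i) = (q < nth 0 m' i).
  by rewrite -!(@mem_beads_runner s) // eq_b.
by rewrite leqNgt H ltnn /= leqNgt -H ltnn.
Qed.

(** * Enumeration of the cores and their total size *)

Lemma is_core3E s la : is_partition la -> is_core3 s la <->
  [/\ closed_sub s (beta la), closed_sub s.+1 (beta la) & closed_sub s.+2 (beta la)].
Proof.
move=> la_part; rewrite /is_core3; split.
  by move=> c; split; apply/core_closed_sub => // i j /c [? []].
move=> [c0 c1 c2] i j ij; split; last split; move: i j ij; exact/core_closed_sub.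
Qed.

(* For every s, the (s,s+1,s+2)-cores form a finite set (enumerated by a
   duplicate-free list L), and h(s), the sum of their sizes, is the
   coefficient of x^s in x^2 (1-2x-3x^2)^(-5/2). *)
Theorem theorem4p2 :
  exists F : nat -> rat, is_pow_m5half F /\
  forall s : nat, exists L : seq (seq nat),
    uniq L /\
    (forall la, la \in L <-> is_partition la /\ is_core3 s la) /\
    (((sumn (map psize L))%:R : rat) = (if (s < 2)%N then 0 else F (s - 2)%N))%R.
Proof.
have [F [F_pow F_sum]] := motzkin_size2_gf; exists F; split=> // s.
have beadsP m : m \in motzkin s 0 ->
    [/\ 0 \notin beads s m, closed_sub s (beads s m),
       closed_sub s.+1 (beads s m) & closed_sub s.+2 (beads s m)].
  move=> mP; have [size_m _ _ _] := mem_motzkin _ _ _ mP.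
  by apply/(closed_sub_heights size_m) => // q i; apply: mem_beads_runner.
exists [seq unbeta (beads s m) | m <- motzkin s 0]; split; last split.
- rewrite map_inj_in_uniq ?motzkin_uniq // => m m' mP m'P eq_u.
  apply: (beads_inj mP m'P).
  have [n0 _ _ _] := beadsP m mP; have [n0' _ _ _] := beadsP m' m'P.
  have [_ <-] := unbetaK (beads_sorted s m) n0.
  by have [_ <-] := unbetaK (beads_sorted s m') n0'; rewrite eq_u.
- move=> la; split.
    case/mapP=> m mP ->; have [n0 c0 c1 c2] := beadsP m mP.
    have [partX bX] := unbetaK (beads_sorted s m) n0.
    by split=> //; apply/is_core3E => //; rewrite bX.
  move=> [la_part /(is_core3E _ la_part)[c0 c1 c2]].
  have [m size_m mE] := runner_heights c1.
  have mP : m \in motzkin s 0.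
    by apply/(closed_sub_heights size_m mE); split=> //; apply: beta_gt0.
  apply/mapP; exists m => //; rewrite -[LHS]betaK; congr unbeta.
  (* Both [beta la] and the beads are strictly decreasing, so equal membership makes them equal. *)
  apply: (irr_sorted_eq (leT := gtn)) => [x y z /= ? /ltn_trans|x|||x]; first exact.
  + exact: ltnn.
  + exact: beta_sorted.
  + exact: beads_sorted.
  + by rewrite mem_beads [in LHS](divn_eq x s.+1) mE // -ltnS ltn_mod.
have two0 : (2 : rat)%R != 0%R by [].
apply: (mulfI two0); rewrite sumnE big_map natr_sum mulr_sumr big_map.
rewrite (eq_big_seq w_size2) ?F_sum => [|m mP].
  by case: ifP; rewrite ?mulr0.
have [n0 _ _ _] := beadsP m mP; have [size_m _ _ _] := mem_motzkin _ _ _ mP.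
exact: psize_beads.
Qed.
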